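(* Let $t_0>0$, assume that $T>t_0$ and that the system $x'+Ax=Bu$, $x(0)=x_0$ is exactly controllable using $L^2$-controls in time $t_0$. Let $x_d\in X$ be a holdable desired state with corresponding constant control $u_d\in U$. For $\gamma>0$ consider the problem $$\mathbf{P}(T,\gamma):\quad \min_{u\in L^2(0,T;U)}\ \tfrac12\,\|u-u_d\|^2_{L^2(0,T;U)}+\gamma\,\max_{t\in[t_0,T]}\|x(t)-x_d\|_X\quad\text{subject to}\quad x'+Ax=Bu,\ x(0)=x_0 .$$ If $\gamma>0$ is sufficiently large (that is, there is $\gamma_0>0$ such that the following holds for all $\gamma>\gamma_0$), then the solution $(u_T,x_T)$ (optimal control and corresponding state) of $\mathbf{P}(T,\gamma)$ satisfies $$x_T(t)=x_d\qquad\text{for all } t\in[t_0,T].$$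
   Context: $X$ and $U$ are Hilbert spaces with norms $\|\cdot\|_X$, $\|\cdot\|_U$. The operator $-A:\mathcal{D}(A)\subset X\to X$ generates a strongly continuous semigroup on $X$, and $B$ is an admissible control operator for it (in the standard sense: $B$ is bounded from $U$ into the extrapolation space $X_{-1}$ and the input-to-state maps take $L^2(0,t;U)$ boundedly into $X$), so that for every $T>0$, $x_0\in X$ and $u\in L^2(0,T;U)$ the Cauchy problem $x'+Ax=Bu$, $x(0)=x_0$ has a unique (mild) solution $x\in C([0,T];X)$. The initial state $x_0\in X$ is given. Exact controllability using $L^2$-controls in time $t_0$: there is a constant $C_1>0$ such that for all initial states $x_0\in X$ and all terminal states $x_1\in X$ there is $u\in L^2(0,t_0;U)$ such that the solution $x\in C([0,t_0];X)$ of $x'+Ax=Bu$, $x(0)=x_0$ satisfies $x(t_0)=x_1$ and $\|u\|_{L^2(0,t_0;U)}\le C_1(\|x_0\|_X+\|x_1\|_X)$. Holdable state: $x_d\in X$ is holdable with constant control $u_d\in U$ if a control steering $x_0$ to $x_d$ at time $t_0$ can be extended to $[0,T]$ by the constant control $u_d$ on $(t_0,T)$ with the corresponding state equal to $x_d$ for all $t\in(t_0,T)$; that is, $Ax_d=Bu_d$ (in $X_{-1}$). In $\|u-u_d\|_{L^2(0,T;U)}$, $u_d$ is regarded as a constant function of time. *)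

(* Defs.v *)
(* Spaces are real; complex Hilbert spaces are covered by restriction of
   scalars, with inner product Re <x, y>. *)
From HB Require Import structures.
From mathcomp Require Import all_boot all_order all_algebra.
From mathcomp Require Import all_classical all_reals all_analysis.

Set Implicit Arguments.
Unset Strict Implicit.
Unset Printing Implicit Defensive.

Import Order.TTheory GRing.Theory Num.Theory.
Import numFieldNormedType.Exports.

Local Open Scope classical_set_scope.
Local Open Scope ring_scope.

Definition hilbert_norm (R : realType) (V : normedModType R) : Prop :=
  exists ip : V -> V -> R,
    [/\ forall x y, ip x y = ip y x,
        forall a x y z, ip (a *: x + y) z = a * ip x z + ip y z
      & forall x, ip x x = `|x| ^+ 2].

Section VectorIntegration.
Context {R : realType} {V : normedModType R}.
Implicit Types (D : set R) (f : R -> V).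

Definition simple_function f : Prop :=
  finite_set (range f) /\ forall v, measurable (f @^-1` [set v]).

(* [fine] is harmless for D of finite measure, the only case used. *)
Definition simple_integral D f : V :=
  \sum_(v \in range f)
    fine ((@lebesgue_measure R) (D `&` f @^-1` [set v])) *: v.

(* Convergence is required everywhere on D, for Borel simple functions; every
   Bochner measurable class of functions on D has such a representative. *)
Definition strongly_measurable D f : Prop :=
  exists s : nat -> R -> V,
    (forall n, simple_function (s n)) /\
    (forall t, D t -> s n t @[n --> \oo] --> f t).

(* f is Bochner integrable on D, with integral z *)
Definition is_bochner_integral D f (z : V) : Prop :=
  strongly_measurable D f /\
  exists s : nat -> R -> V,
    [/\ forall n, simple_function (s n),
        (\int[@lebesgue_measure R]_(t in D) (`|f t - s n t|)%:E)%E
          @[n --> \oo] --> 0%E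
      & simple_integral D (s n) @[n --> \oo] --> z].

(* Elements of L^2(0, T; V) are represented by functions on R of which only
   the restriction to [0, T] matters. *)
Definition in_L2 (T : R) f : Prop :=
  strongly_measurable `[0, T] f /\
  (\int[@lebesgue_measure R]_(t in `[0%R, T]) (`|f t| ^+ 2)%:E < +oo)%E.

Definition L2norm (T : R) f : R :=
  Num.sqrt
    (fine (\int[@lebesgue_measure R]_(t in `[0%R, T]) (`|f t| ^+ 2)%:E)%E).

End VectorIntegration.

Section Semigroups.
Context {R : realType} {X : normedModType R}.
Implicit Types (S : R -> {linear X -> X}) (domA : set X) (A : X -> X).

(* Only the values S t with 0 <= t are meaningful. *)
Definition C0_semigroup S : Prop :=
  [/\ forall t, 0 <= t -> continuous (S t),
      forall x, S 0 x = x,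
      forall s t, 0 <= s -> 0 <= t -> forall x, S (s + t) x = S s (S t x)
    & forall x, S t x @[t --> 0^'+] --> x].

(* The operator -A with domain domA is the infinitesimal generator of S,
   expressed as an equality of graphs; A is arbitrary outside domA. *)
Definition generated_by_opp S domA A : Prop :=
  forall x y, (domA x /\ - A x = y) <->
              (h^-1 *: (S h x - x) @[h --> 0^'+] --> y).

(* beta belongs to the resolvent set of -A, and Rb = (beta + A)^-1 *)
Definition is_resolvent domA A (beta : R) (Rb : {linear X -> X}) : Prop :=
  [/\ continuous Rb,
      forall y, domA (Rb y) /\ beta *: Rb y + A (Rb y) = y
    & forall x, domA x -> Rb (beta *: x + A x) = x].

(* The complete space V is, through the embedding j, a completion of X for the
   norm x |-> |(beta + A)^-1 x|.  Such a completion is unique up to isometry,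
   and another choice of beta yields an equivalent norm. *)
Definition extrapolation_space domA A (V : completeNormedModType R)
    (j : {linear X -> V}) : Prop :=
  dense (range j) /\
  exists (beta : R) (Rb : {linear X -> X}),
    is_resolvent domA A beta Rb /\ forall x, `|j x| = `|Rb x|.

(* As range j is dense, Sm1 t is uniquely determined for 0 <= t. *)
Definition extends_semigroup S (V : normedModType R) (j : {linear X -> V})
    (Sm1 : R -> {linear V -> V}) : Prop :=
  forall t, 0 <= t ->
    continuous (Sm1 t) /\ forall x, Sm1 t (j x) = j (S t x).

(* As domA is dense in X, Am1 is uniquely determined. *)
Definition extends_generator domA A (V : normedModType R) (j : {linear X -> V})
    (Am1 : {linear X -> V}) : Prop :=
  continuous Am1 /\ forall x, domA x -> Am1 x = j (A x).

End Semigroups.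

Section ControlSystem.
Context {R : realType} {X U V : normedModType R}.
Variables (S : R -> {linear X -> X}) (j : {linear X -> V})
  (Sm1 : R -> {linear V -> V}) (B : {linear U -> V}).

(* V plays the role of X_{-1}.  The integral is taken in V, and z is the
   element of X with which its value is identified by the injection j. *)
Definition is_input_to_state (t : R) (u : R -> U) (z : X) : Prop :=
  is_bochner_integral `[0, t] (fun s => Sm1 (t - s) (B (u s))) (j z).

Definition admissible_control_operator : Prop :=
  continuous B /\
  forall t, 0 < t -> exists K : R, forall u, in_L2 t u ->
    exists z, is_input_to_state t u z /\ `|z| <= K * L2norm t u.

(* x(t) = S(t) x0 + \int_0^t S_{-1}(t - s) B u(s) ds for t in [0, T] *)
Definition mild_solution (T : R) (x0 : X) (u : R -> U) (x : R -> X) : Prop :=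
  {within `[0, T], continuous x} /\
  forall t, 0 <= t <= T -> is_input_to_state t u (x t - S t x0).

Definition exactly_controllable (t0 : R) : Prop :=
  exists2 C1 : R, 0 < C1 & forall x0 x1 : X,
    exists (u : R -> U) (x : R -> X),
      [/\ in_L2 t0 u, mild_solution t0 x0 u x, x t0 = x1
        & L2norm t0 u <= C1 * (`|x0| + `|x1|)].

Definition holdable (Am1 : {linear X -> V}) (xd : X) (ud : U) : Prop :=
  Am1 xd = B ud.

(* The supremum is a maximum, x being continuous on [0, T]. *)
Definition objective (t0 T gamma : R) (xd : X) (ud : U)
    (u : R -> U) (x : R -> X) : R :=
  2^-1 * L2norm T (fun t => u t - ud) ^+ 2
  + gamma * sup [set `|x t - xd| | t in `[t0, T]].

Definition feasible (T : R) (x0 : X) (u : R -> U) (x : R -> X) : Prop :=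
  in_L2 T u /\ mild_solution T x0 u x.

Definition solves_P (t0 T gamma : R) (x0 xd : X) (ud : U)
    (u : R -> U) (x : R -> X) : Prop :=
  feasible T x0 u x /\
  forall u' x', feasible T x0 u' x' ->
    objective t0 T gamma xd ud u x <= objective t0 T gamma xd ud u' x'.

End ControlSystem.

(* Main.v *)
(* The penalty term is exact.  Let m be the maximal deviation of the optimal
   state from xd on [t0, T] and suppose m > 0.  Exact controllability gives a
   correction of norm at most C m which steers 0 to xd - x_T(t0); adding it to
   the optimal control on [0, t0] and switching to ud afterwards gives a
   feasible control with vanishing penalty.  By
   |p + q|^2 <= (1 + m) |p|^2 + (1 + 1/m) |q|^2 the quadratic cost increases by
   O(m) only, with a constant independent of gamma since the cost of an exact
   control followed by ud bounds the optimal value; the gain gamma m wins for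
   large gamma.  That the state stays at xd under ud rests on
   \int_a^t S_{-1}(t - s) A xd ds = xd - S(t - a) xd in X_{-1}, which
   (beta + A) : X -> X_{-1} carries over from the orbit of A y in X, where
   y = (beta + A)^-1 xd lies in the domain of A. *)
Require Import Defs.
From HB Require Import structures.
From mathcomp Require Import all_boot all_order all_algebra.
From mathcomp Require Import all_classical all_reals all_analysis.
From mathcomp Require Import measurable_realfun finmap ring lra.

Set Implicit Arguments.
Unset Strict Implicit.
Unset Printing Implicit Defensive.

Import Order.TTheory GRing.Theory Num.Theory.
Import numFieldNormedType.Exports.
Local Open Scope classical_set_scope.
Local Open Scope ring_scope.

(** * Finitely valued functions and the simple integral *)

Section FinitelyValued.
Context {R : realType}.
Local Notation mu := (@lebesgue_measure R).

(** For [I] a normed module this unfolds to [simple_function]; an arbitrary type also admits pairs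
    of simple functions and [nat]-valued indices. *)
Definition finitely_valued (I : Type) (h : R -> I) : Prop :=
  finite_set (range h) /\ forall i, measurable (h @^-1` [set i]).

(** [Y] can be arbitrary because its preimage is a finite union of fibres. *)
Lemma finitely_valued_measurable (I : Type) (h : R -> I) (Y : set I) :
  finitely_valued h -> measurable (h @^-1` Y).
Proof.
move=> [fh mh].
have -> : h @^-1` Y = \bigcup_(i in range h `&` Y) (h @^-1` [set i]).
  apply/seteqP; split=> [t Yt|t [i [_ Yi] /= ->//]].
  by exists (h t).
apply: fin_bigcup_measurable => //.
by apply: sub_finite_set fh => i [].
Qed.

Lemma finitely_valued_comp (I J : Type) (phi : I -> J) (h : R -> I) :
  finitely_valued h -> finitely_valued (phi \o h).
Proof.
move=> fh; split; last first.
  move=> j; rewrite comp_preimage; exact: finitely_valued_measurable.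
have -> : range (phi \o h) = phi @` range h by rewrite image_comp.
exact: finite_image (proj1 fh).
Qed.

Lemma finitely_valued_pair (I J : Type) (g : R -> I) (h : R -> J) :
  finitely_valued g -> finitely_valued h ->
  finitely_valued (fun t => (g t, h t)).
Proof.
move=> [fg mg] [fh mh]; split.
  apply: sub_finite_set (finite_setX fg fh).
  by move=> _ [t _ <-]; split; exists t.
move=> [i j].
rewrite (_ : _ @^-1` _ = g @^-1` [set i] `&` h @^-1` [set j]).
  exact: measurableI.
by apply/seteqP; split=> [t [<- <-]//|t [/= <- <-]].
Qed.

Lemma finitely_valued_map2 (I J K : Type) (op : I -> J -> K)
    (g : R -> I) (h : R -> J) :
  finitely_valued g -> finitely_valued h ->
  finitely_valued (fun t => op (g t) (h t)).
Proof.
move=> fg fh.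
exact: (finitely_valued_comp (fun p => op p.1 p.2)
  (finitely_valued_pair fg fh)).
Qed.

Lemma finitely_valued_cst (I : Type) (i : I) :
  finitely_valued (fun _ : R => i).
Proof.
split; first by apply: sub_finite_set (finite_set1 i) => _ [t _ <-].
move=> k; have [->|ki] := pselect (i = k).
  by rewrite (_ : _ @^-1` _ = setT) //; apply/seteqP; split.
by rewrite (_ : _ @^-1` _ = set0) //; apply/seteqP; split.
Qed.

Lemma finitely_valued_mem (D : set R) :
  measurable D -> finitely_valued (fun t => t \in D).
Proof.
move=> mD; split.
  have := @finite_finset bool setT.
  by apply: sub_finite_set.
move=> [].
  by rewrite (_ : _ @^-1` _ = D) //; apply/seteqP; split=> t;
    [exact: set_mem|exact: mem_set].
rewrite (_ : _ @^-1` _ = ~` D); first exact: measurableC.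
by apply/seteqP; split=> t /=; [move/negbT; rewrite notin_setE|
  move=> Dt; apply/negbTE; rewrite notin_setE].
Qed.

Lemma finitely_valued_patch (I : Type) (D : set R) (g h : R -> I) :
  measurable D -> finitely_valued g -> finitely_valued h ->
  finitely_valued (fun t => if t \in D then g t else h t).
Proof.
move=> mD fg fh.
have := finitely_valued_pair (finitely_valued_mem mD)
  (finitely_valued_pair fg fh).
exact: (finitely_valued_comp (fun p => if p.1 then p.2.1 else p.2.2)).
Qed.

Lemma finitely_valued_measurable_fun (I : Type) (phi : I -> R) (h : R -> I)
    (D : set R) :
  finitely_valued h -> measurable_fun D (phi \o h).
Proof.
move=> fh mD Y mY; apply: measurableI => //.
rewrite comp_preimage; exact: finitely_valued_measurable.
Qed.

End FinitelyValued.

Section SimpleIntegral.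
Context {R : realType} {V : normedModType R}.
Local Notation mu := (@lebesgue_measure R).
Implicit Types (D : set R).

Lemma lebesgue_fin_numI D (A : set R) :
  measurable D -> (mu D < +oo)%E -> measurable A ->
  mu (D `&` A) \is a fin_num.
Proof.
move=> mD Doo mA; rewrite ge0_fin_numE//; apply: le_lt_trans Doo.
exact: measureIl.
Qed.

(** The fibre of [phi \o h] over [v] is the disjoint union of the fibres of [h] over those [i] with
    [phi i = v], and finite measure of [D] keeps [fine] additive. Taking for [h] a pair of simple
    functions gives a common refinement on which their integrals can be compared. *)
Lemma simple_integral_comp (I : choiceType) (phi : I -> V) (h : R -> I) D :
  measurable D -> (mu D < +oo)%E -> finitely_valued h ->
  simple_integral D (phi \o h) =
  \sum_(i \in range h) fine (mu (D `&` h @^-1` [set i])) *: phi i.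
Proof.
move=> mD Doo fh; have [fin_h mh] := fh.
have mDh i : measurable (D `&` h @^-1` [set i]) by exact: measurableI.
have muoo A : measurable A -> mu (D `&` A) \is a fin_num.
  by move=> mA; exact: lebesgue_fin_numI.
have fin_ph : finite_set (range (phi \o h)).
  exact: (proj1 (finitely_valued_comp phi fh)).
rewrite /simple_integral !fsbig_finite//.
have -> : range (phi \o h) = phi @` range h by rewrite image_comp.
rewrite fset_set_image// [RHS](partition_big_imfset _ phi)/=.
apply: eq_bigr => v _.
transitivity (\sum_(i <- fset_set (range h) | phi i == v)
    fine (mu (D `&` h @^-1` [set i])) *: v); last first.
  by apply: eq_bigr => i /eqP ->.
rewrite -scaler_suml; congr (_ *: _).
rewrite sum_fine; last by move=> i _; exact: muoo.
congr fine.
have -> : D `&` (phi \o h) @^-1` [set v] =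
    \bigcup_(i in [set` [fset i in fset_set (range h) | phi i == v]%fset])
      (D `&` h @^-1` [set i]).
  apply/seteqP; split => [t [Dt /= pv]|t [i /= + [Dt hi]]].
    exists (h t) => //=; rewrite !inE/= pv eqxx andbT.
    change (h t \in fset_set (range h)); rewrite in_fset_set//.
    by apply: mem_set; exists t.
  by rewrite !inE /= => /andP[_ /eqP <-]; split => //=; rewrite hi.
rewrite measure_fin_bigcup; [|exact: finite_fset|
  exact/trivIset_setIl/trivIset_preimage1|by move=> i _; exact: mDh].
rewrite -fsbig_seq ?fset_uniq//= big_fset /=.
by apply: eq_bigr.
Qed.

(** Both sums are compared with the sum over all naturals: fibres over values outside the range are
    empty, and those over indices from [n] on miss [D]. Off [D] the index may take any value. *)
Lemma simple_integral_index n (phi : nat -> V) (h : R -> nat) D :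
  measurable D -> (mu D < +oo)%E -> finitely_valued h ->
  (forall t, D t -> (h t < n)%N) ->
  simple_integral D (phi \o h) =
  \sum_(i < n) fine (mu (D `&` h @^-1` [set val i])) *: phi i.
Proof.
move=> mD Doo fh hn; rewrite simple_integral_comp//.
rewrite (fsbig_ord _ _ (fun i => fine (mu (D `&` h @^-1` [set i])) *: phi i)).
have e0 A : A `<=` set0 -> fine (mu (D `&` A)) = 0.
  by rewrite subset0 => ->; rewrite setI0 measure0.
transitivity
  (\sum_(i \in [set: nat]) fine (mu (D `&` h @^-1` [set i])) *: phi i).
  apply: fsbig_widen => // i [_ hi] /=; rewrite e0 ?scale0r// => t /= hit.
  by apply: hi; exists t.
apply/esym; apply: fsbig_widen => // i [_ /= /negP]; rewrite -leqNgt => ni.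
rewrite (_ : _ `&` _ = set0) ?measure0 ?scale0r//.
apply/seteqP; split=> // t [/hn + /= hti]; by rewrite hti ltnNge ni.
Qed.

Lemma simple_integralD (s s' : R -> V) D :
  measurable D -> (mu D < +oo)%E -> simple_function s -> simple_function s' ->
  simple_integral D (fun t => s t + s' t) =
  simple_integral D s + simple_integral D s'.
Proof.
move=> mD Doo fs fs'; have fp := finitely_valued_pair fs fs'.
rewrite (simple_integral_comp (fun p => p.1 + p.2) mD Doo fp).
rewrite (simple_integral_comp (fun p => p.1) mD Doo fp).
rewrite (simple_integral_comp (fun p => p.2) mD Doo fp).
rewrite -fsbig_split /=; last exact: (proj1 fp).
by under eq_fsbigr do rewrite scalerDr.
Qed.

Lemma eq_simple_integral (s s' : R -> V) D :
  measurable D -> (mu D < +oo)%E -> simple_function s -> simple_function s' ->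
  (forall t, D t -> s t = s' t) ->
  simple_integral D s = simple_integral D s'.
Proof.
move=> mD Doo fs fs' ss'; have fp := finitely_valued_pair fs fs'.
rewrite (simple_integral_comp (fun p => p.1) mD Doo fp).
rewrite (simple_integral_comp (fun p => p.2) mD Doo fp).
apply: eq_fsbigr => -[v w] _ /=.
have [->//|vw] := pselect (v = w).
(* The fibre of the pair over two distinct values misses [D]. *)
rewrite (_ : _ `&` _ = set0) ?measure0 ?scale0r//.
by apply/seteqP; split=> // t [Dt [sv s'w]]; apply: vw; rewrite -sv -s'w ss'.
Qed.

Lemma simple_integral_setU (s : R -> V) D1 D2 :
  measurable D1 -> measurable D2 -> (mu D1 < +oo)%E -> (mu D2 < +oo)%E ->
  [disjoint D1 & D2] -> simple_function s ->
  simple_integral (D1 `|` D2) s = simple_integral D1 s + simple_integral D2 s.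
Proof.
move=> mD1 mD2 D1oo D2oo D12 fs; rewrite /simple_integral.
rewrite -fsbig_split /=; last exact: (proj1 fs).
apply: eq_fsbigr => v _; rewrite -scalerDl -fineD; last 2 first.
- exact: lebesgue_fin_numI (proj2 fs v).
- exact: lebesgue_fin_numI (proj2 fs v).
congr (fine _ *: _); have mv : measurable (s @^-1` [set v]) := proj2 fs v.
rewrite setIUl measureU//; [exact: measurableI|exact: measurableI|].
by rewrite setIACA; move: D12; rewrite disj_set2E => /eqP ->; rewrite set0I.
Qed.

End SimpleIntegral.

Lemma simple_integral_linear (R : realType) (V W : normedModType R)
    (L : {linear V -> W})
    (s : R -> V) (D : set R) :
  measurable D -> (lebesgue_measure D < +oo)%E -> simple_function s ->
  simple_integral D (L \o s) = L (simple_integral D s).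
Proof.
move=> mD Doo fs; rewrite (simple_integral_comp L mD Doo fs) /simple_integral.
rewrite !fsbig_finite; [|exact: (proj1 fs)..].
by rewrite raddf_sum; apply: eq_bigr => v _; rewrite /= linearZ.
Qed.

(** * Bochner integral *)

Section StronglyMeasurable.
Context {R : realType}.
Implicit Types (V W : normedModType R) (D : set R).

Lemma simple_strongly_measurable V D (f : R -> V) :
  simple_function f -> strongly_measurable D f.
Proof. by move=> fs; exists (fun=> f); split=> // t _; exact: cvg_cst. Qed.

Lemma strongly_measurable_cst V D (v : V) :
  strongly_measurable D (fun=> v).
Proof. exact/simple_strongly_measurable/finitely_valued_cst. Qed.

Lemma strongly_measurableS V D D' (f : R -> V) :
  D' `<=` D -> strongly_measurable D f -> strongly_measurable D' f.
Proof. by move=> D'D [s [fs sf]]; exists s; split=> // t /D'D; exact: sf. Qed.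

Lemma eq_strongly_measurable V D (f g : R -> V) :
  (forall t, D t -> f t = g t) ->
  strongly_measurable D f -> strongly_measurable D g.
Proof.
move=> fg [s [fs sf]]; exists s; split=> // t Dt; rewrite -fg//; exact: sf.
Qed.

Lemma strongly_measurableD V D (f g : R -> V) :
  strongly_measurable D f -> strongly_measurable D g ->
  strongly_measurable D (fun t => f t + g t).
Proof.
move=> [s [fs sf]] [s' [fs' sg]]; exists (fun n t => s n t + s' n t).
split=> [n|t Dt].
  exact: (finitely_valued_map2 (fun x y : V => x + y) (fs n) (fs' n)).
by apply: cvgD; [exact: sf|exact: sg].
Qed.

Lemma strongly_measurable_continuous V W D (L : V -> W) (f : R -> V) :
  continuous L -> strongly_measurable D f -> strongly_measurable D (L \o f).
Proof.
move=> cL [s [fs sf]]; exists (fun n => L \o s n).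
split=> [n|t Dt]; first exact: (finitely_valued_comp L (fs n)).
exact: (cvg_comp _ _ (sf t Dt) (cL (f t))).
Qed.

Lemma strongly_measurableU V D1 D2 (f : R -> V) : measurable D1 ->
  strongly_measurable D1 f -> strongly_measurable D2 f ->
  strongly_measurable (D1 `|` D2) f.
Proof.
move=> mD1 [s [fs sf]] [s' [fs' sg]].
exists (fun n t => if t \in D1 then s n t else s' n t).
split=> [n|t D12t]; first exact: (finitely_valued_patch mD1 (fs n) (fs' n)).
case: (boolP (t \in D1)) => [/set_mem D1t|].
  exact: sf.
by rewrite notin_setE => D1t; apply: sg; case: D12t.
Qed.

Lemma strongly_measurable_norm V D (f : R -> V) :
  strongly_measurable D f -> measurable_fun D (fun t => `|f t|).
Proof.
move=> [s [fs sf]].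
apply: (@measurable_fun_cvg _ _ _ _ (fun n t => `|s n t|)) => [n|t Dt].
  exact: (finitely_valued_measurable_fun (fun v : V => `|v|) (fs n)).
by apply: cvg_norm; exact: sf.
Qed.

Lemma strongly_measurable_dist V D (f s : R -> V) :
  strongly_measurable D f -> simple_function s ->
  measurable_fun D (fun t => (`|f t - s t|)%:E).
Proof.
move=> mf fs; apply/measurable_EFinP.
apply: (@strongly_measurable_norm _ _ (fun t => f t - s t)).
apply: strongly_measurableD => //.
exact/simple_strongly_measurable/(finitely_valued_comp (fun v => - v) fs).
Qed.

End StronglyMeasurable.

Section BochnerIntegral.
Context {R : realType}.
Implicit Types (V W : normedModType R) (D : set R).
Local Notation mu := (@lebesgue_measure R).

Lemma eq_bochner_integral V D (f g : R -> V) z :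
  (forall t, D t -> f t = g t) ->
  is_bochner_integral D f z -> is_bochner_integral D g z.
Proof.
move=> fg [mf [s [fs sf sz]]]; split; first exact: eq_strongly_measurable mf.
exists s; split=> //; apply: cvg_trans sf; apply: near_eq_cvg; near=> n.
by apply: eq_integral => t /set_mem/fg ->.
Unshelve. all: by end_near. Qed.

Lemma continuous_linear_lipschitz V W (L : {linear V -> W}) :
  continuous L -> exists2 M : R, 0 < M & forall v, `|L v| <= M * `|v|.
Proof.
by move=> /linear_bounded_continuous/linear_boundedP/pinfty_ex_gt0.
Qed.

(** A continuous linear map is Lipschitz, so it multiplies the integrated error of the approximating
    simple functions by at most a constant. *)
Lemma bochner_integral_linear V W (L : {linear V -> W}) D (f : R -> V) z :
  measurable D -> (mu D < +oo)%E -> continuous L ->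
  is_bochner_integral D f z -> is_bochner_integral D (L \o f) (L z).
Proof.
move=> mD Doo cL [mf [s [fs sf sz]]].
have mLf := strongly_measurable_continuous cL mf.
split=> //; exists (fun n => L \o s n).
have fLs n : simple_function (L \o s n).
  exact: (finitely_valued_comp L (fs n)).
split=> //; last first.
  under eq_fun do rewrite simple_integral_linear//.
  exact: (cvg_comp _ _ sz (cL z)).
have [M M0 LM] := continuous_linear_lipschitz cL.
apply: (@squeeze_cvge _ _ _ _ (fun=> 0%E) _
  (fun n => M%:E * \int[mu]_(t in D) (`|f t - s n t|)%:E)%E).
- near=> n; have mfs := strongly_measurable_dist mf (fs n).
  rewrite integral_ge0//= -ge0_integralZl_EFin//; last exact: ltW.
  apply: ge0_le_integral => //.
  + exact: strongly_measurable_dist mLf (fLs n).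
  + exact: measurable_funeM.
  + by move=> t _; rewrite -EFinM lee_fin -raddfB; exact: LM.
- exact: cvg_cst.
- by rewrite -[X in _ --> X](mule0 M%:E); exact: cvgeZl.
Unshelve. all: by end_near. Qed.

Lemma bochner_integralD V D (f g : R -> V) z z' :
  measurable D -> (mu D < +oo)%E ->
  is_bochner_integral D f z -> is_bochner_integral D g z' ->
  is_bochner_integral D (fun t => f t + g t) (z + z').
Proof.
move=> mD Doo [mf [s [fs sf sz]]] [mg [s' [fs' sg sz']]].
have mfg := strongly_measurableD mf mg.
split=> //; exists (fun n t => s n t + s' n t).
have fss n : simple_function (fun t => s n t + s' n t).
  exact: (finitely_valued_map2 (fun x y : V => x + y) (fs n) (fs' n)).
split=> //; last first.
  under eq_fun do rewrite simple_integralD//.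
  exact: cvgD.
have mfs n : measurable_fun D (fun t => (`|f t - s n t|)%:E).
  exact: strongly_measurable_dist.
have mgs n : measurable_fun D (fun t => (`|g t - s' n t|)%:E).
  exact: strongly_measurable_dist.
apply: (@squeeze_cvge _ _ _ _ (fun=> 0%E) _
  (fun n => \int[mu]_(t in D) (`|f t - s n t|)%:E +
            \int[mu]_(t in D) (`|g t - s' n t|)%:E)%E).
- near=> n; rewrite integral_ge0//= -ge0_integralD//; last 2 first.
  + exact: mfs.
  + exact: mgs.
  apply: ge0_le_integral => //.
  + exact: strongly_measurable_dist.
  + exact: (emeasurable_funD (mfs n) (mgs n)).
  + move=> t _; rewrite -EFinD lee_fin opprD addrACA; exact: ler_normD.
- exact: cvg_cst.
- by rewrite -[X in _ --> X](adde0 0%E); exact: cvgeD.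
Unshelve. all: by end_near. Qed.

Lemma bochner_integral_setU V D1 D2 (f : R -> V) z1 z2 :
  measurable D1 -> measurable D2 -> (mu D1 < +oo)%E -> (mu D2 < +oo)%E ->
  [disjoint D1 & D2] ->
  is_bochner_integral D1 f z1 -> is_bochner_integral D2 f z2 ->
  is_bochner_integral (D1 `|` D2) f (z1 + z2).
Proof.
move=> mD1 mD2 D1oo D2oo D12 [mf1 [s1 [fs1 sf1 sz1]]] [mf2 [s2 [fs2 sf2 sz2]]].
have mf := strongly_measurableU mD1 mf1 mf2.
pose s n t := if t \in D1 then s1 n t else s2 n t.
have fs n : simple_function (s n).
  exact: (finitely_valued_patch mD1 (fs1 n) (fs2 n)).
have sD1 n t : D1 t -> s n t = s1 n t by rewrite /s => /mem_set ->.
have sD2 n t : D2 t -> s n t = s2 n t.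
  rewrite /s => D2t; case: ifPn => // /set_mem D1t.
  by move: D12; rewrite disj_set2E => /eqP/seteqP[/(_ t)]; case.
split=> //; exists s; split=> //.
- rewrite (_ : (fun n => _) = (fun n =>
    \int[mu]_(t in D1) (`|f t - s1 n t|)%:E +
    \int[mu]_(t in D2) (`|f t - s2 n t|)%:E)%E); last first.
    apply/funext => n; rewrite ge0_integral_setU//; last first.
      exact: strongly_measurable_dist.
    congr (_ + _)%E; apply: eq_integral => t /set_mem Dt.
      by rewrite sD1.
    by rewrite sD2.
  by rewrite -[X in _ --> X](adde0 0%E); exact: cvgeD.
- rewrite (_ : (fun n => _) = (fun n =>
    simple_integral D1 (s1 n) + simple_integral D2 (s2 n))); last first.
    apply/funext => n; rewrite simple_integral_setU//; congr (_ + _).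
      by apply: eq_simple_integral => // t; exact: sD1.
    by apply: eq_simple_integral => // t; exact: sD2.
  exact: cvgD.
Qed.

(** On a set of finite measure a uniform error [e] integrates to at most [e] times the measure. This
    makes Riemann sums usable as approximating simple integrals. *)
Lemma bochner_integral_uniform V D (f : R -> V) (s : nat -> R -> V) z :
  measurable D -> (mu D < +oo)%E -> (forall n, simple_function (s n)) ->
  (forall e : R, 0 < e -> \forall n \near \oo, forall t, D t ->
    `|f t - s n t| <= e) ->
  simple_integral D (s n) @[n --> \oo] --> z ->
  is_bochner_integral D f z.
Proof.
move=> mD Doo fs sf sz.
have mf : strongly_measurable D f.
  exists s; split=> // t Dt; apply/cvgrPdist_le => e /sf; apply: filterS => n.
  exact.
split=> //; exists s; split=> //.
have mfs n : measurable_fun D (fun t => (`|f t - s n t|)%:E).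
  exact: strongly_measurable_dist.
have Dfin : mu D \is a fin_num by rewrite ge0_fin_numE.
apply/fine_cvgP.
have le_int (e : R) n : 0 < e -> (forall t, D t -> `|f t - s n t| <= e) ->
    (\int[mu]_(t in D) (`|f t - s n t|)%:E <= (e * fine (mu D))%:E)%E.
  move=> e0 fe; rewrite EFinM fineK// -integral_cst//.
  by apply: ge0_le_integral => //; exact: mfs.
split.
  near=> n; rewrite ge0_fin_numE ?integral_ge0//.
  apply: le_lt_trans (ltry (1 * fine (mu D))); apply: le_int => //.
  by near: n; exact: sf.
apply/cvgr0Pnorm_le => e e0.
(* The added 1 keeps the divisor positive when [D] is a null set. *)
have d0 : 0 < fine (mu D) + 1 by rewrite ltr_wpDl// fine_ge0.
near=> n; rewrite /= ger0_norm ?fine_ge0 ?integral_ge0//.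
have le_e : (\int[mu]_(t in D) (`|f t - s n t|)%:E <=
    (e / (fine (mu D) + 1) * fine (mu D))%:E)%E.
  by apply: le_int; [exact: divr_gt0|near: n; apply: sf; exact: divr_gt0].
apply: (@le_trans _ _ (e / (fine (mu D) + 1) * fine (mu D))).
  rewrite -lee_fin fineK//; rewrite ge0_fin_numE ?integral_ge0//.
  exact: le_lt_trans le_e (ltry _).
by rewrite mulrAC ler_pdivrMr// ler_pM2l// lerDl.
Unshelve. all: by end_near. Qed.

End BochnerIntegral.

(** * Strongly continuous semigroups *)

Lemma cvg_at_rightP (R : realType) (V : normedModType R) (f : R -> V) (l : V) :
  f h @[h --> 0^'+] --> l ->
  forall e : R, 0 < e -> exists2 d : R, 0 < d &
    forall h, 0 < h < d -> `|l - f h| <= e.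
Proof.
move=> /cvgrPdist_le fl e /fl[d /= d0 dH]; exists d => // h /andP[h0 hd].
by apply: dH => //=; rewrite sub0r normrN gtr0_norm.
Qed.

Section Semigroup.
Context {R : realType} {X : completeNormedModType R}.
Variables (S : R -> {linear X -> X}).
Hypothesis hS : C0_semigroup S.

Let S_cont t : 0 <= t -> continuous (S t).
Proof. by case: hS => + _ _ _; exact. Qed.
Let S0 x : S 0 x = x. Proof. by case: hS => _ + _ _; exact. Qed.
Let SD s t : 0 <= s -> 0 <= t -> forall x, S (s + t) x = S s (S t x).
Proof. by case: hS => _ _ + _; exact. Qed.

Lemma semigroup_commute s t x : 0 <= s -> 0 <= t -> S s (S t x) = S t (S s x).
Proof. by move=> s0 t0; rewrite -!SD// addrC. Qed.

Lemma semigroup_right_continuous x (e : R) : 0 < e ->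
  exists2 d : R, 0 < d & forall h, 0 <= h < d -> `|x - S h x| <= e.
Proof.
case: hS => _ _ _ /(_ x)/cvg_at_rightP + e0 => /(_ _ e0)[d d0 dH].
exists d => // h /andP[]; rewrite le_eqVlt => /orP[/eqP <- _|h0 hd].
  by rewrite S0 subrr normr0 ltW.
by apply: dH; rewrite h0.
Qed.

(** Otherwise there are times tending to 0 along which the operator norms blow up. Strong continuity
    at 0 makes these operators pointwise bounded, so the uniform boundedness principle contradicts
    the blow-up. *)
Lemma semigroup_bounded_near0 : exists d M : R, [/\ 0 < d, 1 <= M &
  forall t x, 0 <= t <= d -> `|S t x| <= M * `|x|].
Proof.
apply: contrapT => unbounded.
have /choice[tx tx_unbounded] (n : nat) : exists tx : R * X,
    0 <= tx.1 <= n.+1%:R^-1 /\ n.+1%:R * `|tx.2| < `|S tx.1 tx.2|.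
  apply: contrapT => bounded; apply: unbounded.
  exists n.+1%:R^-1, n.+1%:R; split; rewrite ?invr_gt0 ?ler1n// => t x tn.
  rewrite leNgt; apply/negP => lt; by apply: bounded; exists (t, x).
pose F := [set f : X -> X | exists n, f = S (tx n).1].
have [f [n ->]|x|M FM] := @Banach_Steinhauss _ _ _ F _ _ 1.
- split; last exact: linearP.
  apply/bounded_funP/linear_bounded_continuous/S_cont.
  by have [/andP[]] := tx_unbounded n.
- have cSx : S (tx n).1 x @[n --> \oo] --> x.
    apply/cvgrPdist_le => e /(semigroup_right_continuous x)[d d0 dH].
    near=> n; apply: dH; have [/andP[-> /le_lt_trans + _]] := tx_unbounded n.
    apply; near: n; exact: (near_infty_natSinv_lt (PosNum d0)).
  have /cvg_seq_bounded/ex_bound SM : cvgn (fun n => S (tx n).1 x).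
    by apply/cvg_ex; exists x.
  have [M SxM] := SM (globally_properfilter (Logic.I : setT 0%N)).
  by exists M => _ [n ->]; exact: SxM.
(* This index satisfies [M < n.+1], so the normalised n-th vector violates the uniform bound [M] on
   the unit ball. *)
- pose n := Num.truncn M.
  have [/andP[t0 _] ltS] := tx_unbounded n.
  have x0 : 0 < `|(tx n).2|.
    rewrite normr_gt0; apply/eqP => x0.
    by move: ltS; rewrite x0 linear0 normr0 mulr0 ltxx.
  have := FM (S (tx n).1) (ex_intro _ n erefl) (`|(tx n).2|^-1 *: (tx n).2).
  rewrite linearZ/= !normrZ normfV normr_id mulVf ?gt_eqF// => /(_ (lexx _)).
  rewrite ler_pdivrMl// mulrC => /(lt_le_trans ltS).
  rewrite ltr_pM2r// => /ltW; rewrite leNgt => /negP; apply.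
  exact: truncnS_gt.
Unshelve. all: by end_near. Qed.

Lemma semigroup_bounded (tau : R) : exists2 M : R, 0 < M &
  forall t x, 0 <= t <= tau -> `|S t x| <= M * `|x|.
Proof.
have [d [M [d0 M1 SM]]] := semigroup_bounded_near0.
have M0 : 0 < M by exact: lt_le_trans M1.
have SMn n t x : 0 <= t <= n%:R * d -> `|S t x| <= M ^+ n * `|x|.
  elim: n t x => [|n IH] t x /andP[t0 tn].
    have -> : t = 0 by apply/eqP; rewrite eq_le t0 andbT -(mul0r d).
    by rewrite S0 expr0 mul1r.
  have [td|dt] := leP t d.
    apply: (le_trans (SM _ _ _)); first by rewrite t0.
    by rewrite ler_wpM2r// exprS ler_peMr//; [exact: ltW|exact: exprn_ege1].
  rewrite -[t](subrK d) SD ?subr_ge0 ?(ltW d0)//; last exact: ltW.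
  apply: (le_trans (IH _ _ _)).
    rewrite subr_ge0 (ltW dt)/= lerBlDr -[X in _ + X]mul1r -mulrDl.
    by rewrite -natr1 in tn.
  rewrite exprSr -mulrA ler_wpM2l//; first exact/exprn_ge0/ltW.
  by apply: SM; rewrite lexx ltW.
exists (M ^+ (Num.truncn (tau / d)).+1) => [|t x /andP[t0 tt]].
  exact: exprn_gt0.
apply: SMn; rewrite t0 (le_trans tt)//= -ler_pdivrMr// ltW//.
exact: truncnS_gt.
Qed.

(** For s <= t the difference is S(s) applied to x - S(t - s) x, so the bound on [0, tau] reduces
    uniform continuity to right continuity at 0. *)
Lemma semigroup_unif_continuous (tau : R) x (e : R) : 0 < e ->
  exists2 d : R, 0 < d & forall s t, 0 <= s <= tau -> 0 <= t <= tau ->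
    `|s - t| < d -> `|S s x - S t x| <= e.
Proof.
move=> e0; have [M M0 SM] := semigroup_bounded tau.
have [d d0 dH] := semigroup_right_continuous x (divr_gt0 e0 M0).
exists d => //.
have main s t : 0 <= s -> s <= t -> t <= tau -> t - s < d ->
    `|S s x - S t x| <= e.
  move=> s0 st tt tsd.
  rewrite -[t](subrKC s) SD ?subr_ge0// -linearB.
  apply: (le_trans (SM _ _ _)); first by rewrite s0 (le_trans st).
  by rewrite mulrC -ler_pdivlMr// dH// subr_ge0 st.
move=> s t /andP[s0 stau] /andP[t0 ttau]; have [st|ts] := leP s t.
  by rewrite ler0_norm ?subr_le0// opprB; exact: main.
rewrite gtr0_norm ?subr_gt0// distrC; apply: main => //; exact: ltW.
Qed.

Variables (domA : set X) (A : X -> X).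
Hypothesis hA : generated_by_opp S domA A.

Local Notation E h y := (h^-1 *: (y - S h y)).

Lemma generatorP x y :
  (domA x /\ A x = y) <-> (E h x @[h --> 0^'+] --> y).
Proof.
have -> : (fun h => E h x) = - (fun h => h^-1 *: (S h x - x)).
  by apply/funext => h; rewrite [RHS]/GRing.opp/= -scalerN opprB.
split=> [[dx <-]|cx].
  by rewrite -[A x]opprK; apply: cvgN; apply/hA.
have : h^-1 *: (S h x - x) @[h --> 0^'+] --> - y.
  by rewrite -[F in F @ _]opprK; exact: cvgN.
by move=> /hA[dx /oppr_inj].
Qed.

Lemma generator_linear a x y : domA x -> domA y ->
  domA (a *: x + y) /\ A (a *: x + y) = a *: A x + A y.
Proof.
move=> dx dy; apply/generatorP.
have /generatorP cx : domA x /\ A x = A x by [].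
have /generatorP cy : domA y /\ A y = A y by [].
rewrite (_ : (fun h => _) = (fun h => a *: E h x + E h y)).
  by apply: cvgD => //; apply: cvgZr.
apply/funext => h; rewrite linearP scalerA mulrC -scalerA -scalerDr.
by rewrite opprD addrACA scalerBr.
Qed.

(** S(t) is continuous and commutes with the difference quotients, so it carries their limit
    along. *)
Lemma generator_semigroup t x : 0 <= t -> domA x ->
  domA (S t x) /\ A (S t x) = S t (A x).
Proof.
move=> t0 dx; apply/generatorP.
have /generatorP cx : domA x /\ A x = A x by [].
have cS : S t (E h x) @[h --> 0^'+] --> S t (A x).
  apply: (cvg_comp _ _ cx). by move: (S_cont t0) => /(_ (A x)).
apply: cvg_trans cS; apply: near_eq_cvg; near=> h.
rewrite /= linearZ/= linearB/=.
by rewrite (@semigroup_commute h t)//; near: h; exact: nbhs_right_ge.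
Unshelve. all: by end_near. Qed.

Lemma generator_quotient h y : 0 <= h -> domA y ->
  domA (E h y) /\ A (E h y) = E h (A y).
Proof.
move=> h0 dy; have [dS AS] := generator_semigroup h0 dy.
have [d1 A1] := generator_linear (-1) dS dy.
have [d0 A0] := generator_linear 0 dy dy.
(* This puts 0 in [domA] with [A 0 = 0], so that scaling by [h^-1] becomes the case of
   [generator_linear] with second vector 0. *)
have [dz Az] := generator_linear (-1) dy dy.
move: dz Az; rewrite scaleN1r addNr => dz Az.
have [] := generator_linear h^-1 d1 dz; rewrite !addr0 scaleN1r => dE AE.
rewrite (addrC y) (addrC (A y)) AE; split=> //.
by move: A1; rewrite AS Az !scaleN1r addNr addr0 => ->.
Qed.

End Semigroup.

(** * Uniform subdivisions of a half-open interval *)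

Section SubdivisionIndex.
Context {R : realType} (a t : R) (n : nat).
Hypothesis lt_at : a < t.
Local Notation mesh := ((t - a) / n.+1%:R).

(* The pieces are counted from the right: piece k is
   `]t - (k+1) mesh, t - k mesh]. *)
Definition subdiv_index (s : R) : nat :=
  if s \in `]a, t] then Num.truncn ((t - s) / mesh) else n.+1.

Lemma mesh_gt0 : 0 < mesh. Proof. by rewrite divr_gt0// subr_gt0. Qed.

Lemma subdiv_indexP s : a < s <= t ->
  (subdiv_index s)%:R * mesh <= t - s < (subdiv_index s).+1%:R * mesh.
Proof.
move=> ast; rewrite /subdiv_index in_itv/= ast.
rewrite -ler_pdivlMr ?mesh_gt0// -ltr_pdivrMr ?mesh_gt0//.
apply: truncn_itv; rewrite divr_ge0 ?(ltW mesh_gt0)// subr_ge0.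
by case/andP: ast.
Qed.

(** Because [a] is excluded, t - s < t - a strictly, and the quotient by the mesh stays below n +
    1. *)
Lemma subdiv_index_lt s : a < s <= t -> (subdiv_index s < n.+1)%N.
Proof.
move=> ast; have /andP[+ _] := subdiv_indexP ast.
rewrite mulrA ler_pdivrMr// => le_ts; rewrite -(ltr_nat R).
have: (subdiv_index s)%:R * (t - a) < n.+1%:R * (t - a).
  apply: (le_lt_trans le_ts); rewrite mulrC ltr_pM2l//.
  by rewrite ltrD2l ltrN2; case/andP: ast.
by rewrite ltr_pM2r// subr_gt0.
Qed.

Lemma subdiv_index_preimage (k : nat) : (k < n.+1)%N ->
  subdiv_index @^-1` [set k] = `]t - k.+1%:R * mesh, t - k%:R * mesh]%classic.
Proof.
move=> kn; have m0 := mesh_gt0.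
have mesh_le : k.+1%:R * mesh <= t - a.
  by rewrite mulrA ler_pdivrMr// mulrC ler_pM2l ?subr_gt0// ler_nat.
apply/seteqP; split=> s /=; rewrite in_itv/=.
  have [ast <-|nast] := boolP (a < s <= t).
    have /andP[h1 h2] := subdiv_indexP ast.
    by rewrite ltrBlDl -ltrBlDr h2/= lerBrDl -lerBrDr.
  rewrite /subdiv_index in_itv/= (negbTE nast) => nk.
  by rewrite -nk ltnn in kn.
move=> /andP[sk ks].
have ast : a < s <= t.
  apply/andP; split; first by apply: le_lt_trans sk; rewrite lerBrDl -lerBrDr.
  by apply: (le_trans ks); rewrite gerBl mulr_ge0// ltW.
rewrite /subdiv_index in_itv/= ast; apply: truncn_def.
by rewrite ler_pdivlMr// ltr_pdivrMr// lerBrDl -lerBrDr ks ltrBlDl -ltrBlDr.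
Qed.

Lemma subdiv_index_finitely_valued : finitely_valued subdiv_index.
Proof.
have le_index s : (subdiv_index s <= n.+1)%N.
  have [/subdiv_index_lt/ltnW//|nast] := boolP (a < s <= t).
  by rewrite /subdiv_index in_itv/= (negbTE nast).
split.
  by apply: sub_finite_set (finite_II n.+2) => _ [s _ <-] /=; rewrite ltnS.
move=> k; have [kn|] := ltnP k n.+1.
  by rewrite subdiv_index_preimage.
(* The value n + 1 is the default off ]a, t], so its fibre is the complement of that interval;
   larger values are never taken. *)
rewrite leq_eqVlt => /orP[/eqP<-|nk]; last first.
  rewrite (_ : _ @^-1` _ = set0)//; apply/seteqP; split=> // s /= sk.
  by have := le_index s; rewrite sk leqNgt nk.
rewrite (_ : _ @^-1` _ = ~` `]a, t]%classic); first exact: measurableC.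
apply/seteqP; split=> s /=; rewrite in_itv/=.
  by move=> sn /subdiv_index_lt; rewrite sn ltnn.
by move=> /negP/negbTE nast; rewrite /subdiv_index in_itv/= nast.
Qed.

Lemma lebesgue_subdiv_index (k : nat) : (k < n.+1)%N ->
  lebesgue_measure (`]a, t]%classic `&` subdiv_index @^-1` [set k]) = mesh%:E.
Proof.
move=> kn; have m0 := mesh_gt0.
have -> : `]a, t]%classic `&` subdiv_index @^-1` [set k] =
    subdiv_index @^-1` [set k].
  apply/setIidPr => s /= sk; rewrite in_itv/=; apply: contraPT sk => nast.
  rewrite /subdiv_index in_itv/= (negbTE nast).
  by move=> nk; rewrite -nk ltnn in kn.
rewrite subdiv_index_preimage// lebesgue_measure_itv/= lte_fin.
rewrite ifT; last by rewrite ltrD2l ltrN2 ltr_pM2r// ltr_nat.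
by rewrite -EFinB; congr (_%:E); rewrite -natr1; ring.
Qed.

End SubdivisionIndex.

(** * The integral of a semigroup orbit *)

Section OrbitIntegral.
Context {R : realType} {X : completeNormedModType R}.
Variables (S : R -> {linear X -> X}) (domA : set X) (A : X -> X).
Hypotheses (hS : C0_semigroup S) (hA : generated_by_opp S domA A).
Local Notation E h y := (h^-1 *: (y - S h y)).

(** This is the fundamental theorem of calculus for the orbit of [y], by Riemann sums. The orbit of
    [A y] is uniformly approximated by step functions, and y - S(t - a) y is exactly the same
    Riemann sum with [A y] replaced by the difference quotient of [y] at the mesh. The quotient
    tends to [A y] and the operators are uniformly bounded, so both sums have the same limit. *)
Lemma bochner_integral_orbit a t y : a < t -> domA y ->
  is_bochner_integral `]a, t] (fun s => S (t - s) (A y)) (y - S (t - a) y).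
Proof.
move=> lt_at dy.
pose d n : R := (t - a) / n.+1%:R.
have d0 n : 0 < d n by exact: mesh_gt0.
have d_lt e : 0 < e -> \forall n \near \oo, d n < e.
  move=> e0; have ea0 : 0 < e / (t - a) by rewrite divr_gt0 ?subr_gt0.
  near=> n; rewrite /d mulrC -ltr_pdivlMr ?subr_gt0//.
  by near: n; exact: (near_infty_natSinv_lt (PosNum ea0)).
pose h n := subdiv_index a t n.
(* On piece k the smallest value of t - s is k times the mesh, attained at its right end. *)
pose phi n k := S (k%:R * d n) (A y).
have fh n : finitely_valued (h n) by exact: subdiv_index_finitely_valued.
have D_oo : (lebesgue_measure `]a, t]%classic < +oo)%E.
  by rewrite lebesgue_measure_itv/=; case: ifPn => _; rewrite ?ltry.
apply: (@bochner_integral_uniform _ _ _ _ (fun n => phi n \o h n)) => //.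
- by move=> n; exact: (finitely_valued_comp (phi n)).
- move=> e e0.
  have [del del0 unif] := semigroup_unif_continuous hS (t - a) (A y) e0.
  near=> n => s; rewrite /= in_itv/= => ast.
  have /andP[h1 h2] : (h n s)%:R * d n <= t - s < (h n s).+1%:R * d n.
    exact: subdiv_indexP.
  have hd0 : 0 <= (h n s)%:R * d n by rewrite mulr_ge0// ltW.
  have /andP[as_ st] := ast.
  have dn : d n < del by near: n; exact: d_lt.
  apply: unif.
  + by apply/andP; split; lra.
  + apply/andP; split=> //; apply: (le_trans h1); lra.
  + rewrite ger0_norm ?subr_ge0//; apply: le_lt_trans dn.
    by rewrite lerBlDl; move: h2; rewrite -natr1 mulrDl mul1r => /ltW.
- have ->: (fun n => simple_integral `]a, t] (phi n \o h n)) = (fun n =>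
    \sum_(k < n.+1) d n *: S (k%:R * d n) (A y)).
    apply/funext => n.
    rewrite (@simple_integral_index _ _ n.+1)//; last first.
      by move=> s; rewrite /= in_itv/=; exact: subdiv_index_lt.
    apply: eq_bigr => k _; congr (_ *: _).
    by rewrite /h lebesgue_subdiv_index//; case: k.
  (* Term k equals S(k d) y - S((k + 1) d) y with d the mesh, so the sum telescopes. *)
  have tel n : y - S (t - a) y =
      \sum_(k < n.+1) d n *: S (k%:R * d n) (E (d n) y).
    rewrite -(big_mkord xpredT (fun k => d n *: S (k%:R * d n) (E (d n) y))).
    rewrite (telescope_sumr_eq (fun k => - S (k%:R * d n) y))//.
      have -> : n.+1%:R * d n = t - a by rewrite /d mulrC divfK.
      by case: hS => _ S0 _ _; rewrite mul0r S0 opprK [RHS]addrC.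
    move=> k _; rewrite linearZ/= scalerA divff ?scale1r ?gt_eqF//.
    case: hS => _ _ SD _; rewrite linearB/= opprK [RHS]addrC; congr (_ - _).
    have dn0 : 0 <= d n by exact: ltW.
    by rewrite -natr1 mulrDl mul1r SD// mulr_ge0.
  have [M M0 SM] := semigroup_bounded hS (t - a).
  apply/cvgrPdist_le => e e0.
  have cM0 : 0 < (t - a) * M by rewrite mulr_gt0// subr_gt0.
  have cE : E h y @[h --> 0^'+] --> A y by apply/(generatorP hA).
  (* Each of the n + 1 terms contributes mesh times [M] times this tolerance; together they give
     [e]. *)
  have [del del0 dH] := cvg_at_rightP cE (divr_gt0 e0 cM0).
  near=> n; rewrite (tel n) -sumrB.
  apply: (le_trans (ler_norm_sum _ _ _)).
  apply: (@le_trans _ _ (\sum_(k < n.+1) d n * (M * (e / ((t - a) * M))))).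
    apply: ler_sum => k _; rewrite -scalerBr -linearB normrZ gtr0_norm//.
    rewrite ler_pM2l//; apply: (le_trans (SM _ _ _)).
      rewrite mulr_ge0// ?(ltW (d0 n))//= /d mulrA ler_pdivrMr// mulrC.
      by rewrite ler_pM2l ?subr_gt0// ler_nat ltnW.
    rewrite ler_pM2l// distrC; apply: dH; rewrite d0/=.
    by near: n; exact: d_lt.
  rewrite sumr_const card_ord /d.
  rewrite -[X in X <= _]mulr_natl le_eqVlt; apply/orP; left; apply/eqP.
  field; rewrite !gt_eqF ?subr_gt0//= ltr0n//.
Unshelve. all: by end_near. Qed.

End OrbitIntegral.

(** * The extrapolation space *)

(** The set where the functions differ is open, so if nonempty it would meet [D]. *)
Lemma dense_continuous_eq (R : realType) (T : topologicalType)
    (V : normedModType R) (D : set T) (f g : T -> V) :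
  dense D -> continuous f -> continuous g ->
  (forall x, D x -> f x = g x) -> forall x, f x = g x.
Proof.
move=> dD cf cg fg x; apply: contrapT => fgx.
pose O := [set y | f y - g y != 0].
have O0 : O !=set0 by exists x; rewrite /O /= subr_eq0; exact/eqP.
have oO : open O.
  rewrite (_ : O = (fun y => f y - g y) @^-1` ~` [set 0]); last first.
    by apply/seteqP; split=> y /= /eqP.
  apply: open_comp => [y _|].
    by apply: continuousB; [exact: cf|exact: cg].
  exact/closed_openC/accessible_closed_set1/hausdorff_accessible/norm_hausdorff.
have [y [+ /fg fgy]] := dD O O0 oO.
by rewrite /O /= fgy subrr eqxx.
Qed.

Section Extrapolation.
Context {R : realType} {X V : completeNormedModType R}.
Variables (S : R -> {linear X -> X}) (domA : set X) (A : X -> X).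
Hypotheses (hS : C0_semigroup S) (hA : generated_by_opp S domA A).
Variable j : {linear X -> V}.
Hypothesis hj : extrapolation_space domA A j.
Variable Sm1 : R -> {linear V -> V}.
Hypothesis hSm1 : extends_semigroup S j Sm1.
Variable Am1 : {linear X -> V}.
Hypothesis hAm1 : extends_generator domA A j Am1.

Lemma extended_semigroupD s t v : 0 <= s -> 0 <= t ->
  Sm1 (s + t) v = Sm1 s (Sm1 t v).
Proof.
move=> s0 t0; have [cs js] := hSm1 s0; have [ct jt] := hSm1 t0.
have [cst jst] := hSm1 (addr_ge0 s0 t0); have [dj _] := hj.
apply: (@dense_continuous_eq _ _ _ _ (Sm1 (s + t)) (Sm1 s \o Sm1 t) dj) => //.
  by move=> w; apply: continuous_comp; [exact: ct|exact: cs].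
by move=> _ [x _ <-] /=; rewrite jst jt js; case: hS => _ _ ->.
Qed.

Lemma extrapolation_embedding_continuous : continuous j.
Proof.
have [_ [beta [Rb [[cRb _ _] jRb]]]] := hj.
move=> x; apply/cvgrPdist_le => e e0; near=> y.
rewrite -linearB jRb linearB; near: y.
by move: e e0; apply/cvgrPdist_le; exact: cRb.
Unshelve. all: by end_near. Qed.

(* For K = beta j + Am1 one has K Rb = j and Sm1 s K = K S s, so the claim is
   the image under K of the integral of the orbit of A (Rb xd) in X. *)
Lemma bochner_integral_extended_orbit a t xd : a < t ->
  is_bochner_integral `]a, t] (fun s => Sm1 (t - s) (Am1 xd))
    (j (xd - S (t - a) xd)).
Proof.
move=> lt_at; have [cAm1 Am1E] := hAm1.
have [_ [beta [Rb [[cRb RbP RbK] jRb]]]] := hj.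
pose K : {linear X -> V} := (beta \*: j) \+ Am1.
have KE x : K x = beta *: j x + Am1 x by [].
have cK : continuous K.
  move=> x; apply: continuousD; last exact: cAm1.
  by apply: continuousZr; exact: extrapolation_embedding_continuous.
have KdomA z : domA z -> K z = j (beta *: z + A z).
  by move=> dz; rewrite KE Am1E// linearD linearZ.
have KRb x : K (Rb x) = j x.
  by have [dR RE] := RbP x; rewrite KdomA// RE.
(* The resolvent commutes with the semigroup: beta + A maps S(s) Rb x to S(s) x. *)
have SRb s x : 0 <= s -> S s (Rb x) = Rb (S s x).
  move=> s0; have [dR RE] := RbP x.
  have [dS AS] := generator_semigroup hS hA s0 dR.
  by rewrite -[LHS]RbK// AS -linearZ -linearD RE.
have [dy yE] := RbP xd; set y := Rb xd in dy yE *.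
(* Since A y = xd - beta y and K y = j xd, the two terms beta j xd cancel. *)
have KAy : K (A y) = Am1 xd.
  have -> : A y = xd - beta *: y by rewrite -yE addrAC subrr add0r.
  by rewrite linearB linearZ [K y]KRb KE addrAC subrr add0r.
(* The vector [A y] may lie outside [domA], where [K] has no formula through [A]. The difference
   quotients of [y] stay in [domA]; the commutation is checked on them and passes to the limit. *)
have SK s : 0 <= s -> Sm1 s (K (A y)) = K (S s (A y)).
  move=> s0; have [cs js] := hSm1 s0.
  have cE : h^-1 *: (y - S h y) @[h --> 0^'+] --> A y.
    by apply/(generatorP hA).
  have cvgE (L : X -> V) : continuous L ->
      L (h^-1 *: (y - S h y)) @[h --> 0^'+] --> L (A y).
    by move=> cL; exact: (cvg_comp _ _ cE (cL (A y))).
  have c1 := cvgE (Sm1 s \o K) (fun x => continuous_comp (cK x) (cs (K x))).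
  have cSs : continuous (S s) by case: hS => + _ _ _; exact.
  have c2 := cvgE (K \o S s) (fun x => continuous_comp (cSs x) (cK (S s x))).
  have c3 : (Sm1 s \o K) (h^-1 *: (y - S h y)) @[h --> 0^'+] -->
      (K \o S s) (A y).
    apply: cvg_trans c2; apply: near_eq_cvg.
    near=> h; have h0 : 0 <= h by near: h; exact: nbhs_right_ge.
    have [dE AE] := generator_quotient hS hA h0 dy.
    have [dS AS] := generator_semigroup hS hA s0 dE.
    rewrite /comp (KdomA _ dE) (KdomA _ dS) js AS.
    by rewrite [S s (_ + _)]linearD [S s (beta *: _)]linearZ.
  exact: (cvg_unique _ c1 c3).
have -> : j (xd - S (t - a) xd) = K (y - S (t - a) y).
  have at0 : 0 <= t - a by rewrite subr_ge0 ltW.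
  rewrite (linearB K) (SRb _ _ at0) [K y]KRb [K (Rb _)]KRb.
  by rewrite linearB.
have D_oo : (lebesgue_measure (`]a, t]%classic : set R) < +oo)%E.
  by rewrite lebesgue_measure_itv/=; case: ifPn => _; rewrite ?ltry.
apply: eq_bochner_integral (bochner_integral_linear _ D_oo cK
  (bochner_integral_orbit hS hA lt_at dy)) => //.
move=> s /=; rewrite in_itv/= => /andP[_ st].
by rewrite -KAy; apply/esym/SK; rewrite subr_ge0.
Unshelve. all: by end_near. Qed.

End Extrapolation.

(** * Controls and mild solutions *)

Section SquareIntegrable.
Context {R : realType} {V : normedModType R}.
Implicit Types (D : set R) (f g : R -> V) (T : R).
Local Notation mu := (@lebesgue_measure R).

Lemma lebesgue_itvcc_lty T : (mu `[0%R, T]%classic < +oo)%E.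
Proof. by rewrite lebesgue_measure_itv/=; case: ifPn => _; rewrite ?ltry. Qed.

Lemma itvcc_setU (t0 T : R) : 0 <= t0 <= T ->
  `[0, T]%classic = `[0, t0] `|` `]t0, T] :> set R.
Proof.
move=> /andP[t00 t0T]; apply/seteqP; split=> t /=; rewrite !in_itv/=.
  by move=> /andP[-> ->]; case: (leP t t0); [left|right].
by move=> [] /andP[]; [move=> -> /le_trans; exact|
  move=> /ltW/(le_trans t00) -> ->].
Qed.

Lemma itvcc_disjoint (t0 T : R) :
  [disjoint `[0, t0]%classic & `]t0, T]%classic : set R].
Proof.
rewrite disj_set2E; apply/eqP/seteqP; split=> // t [] /=; rewrite !in_itv/=.
by move=> /andP[_ tt0] /andP[]; rewrite ltNge tt0.
Qed.

Lemma measurable_sqr_norm D f : strongly_measurable D f ->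
  measurable_fun D (fun t => (`|f t| ^+ 2)%:E).
Proof.
move=> mf; apply/measurable_EFinP/measurable_funX.
exact: strongly_measurable_norm.
Qed.

Lemma sqr_norm_integralD_le D f g (m : R) : 0 < m -> measurable D ->
  strongly_measurable D f -> strongly_measurable D g ->
  (\int[mu]_(t in D) (`|(f t + g t)%R| ^+ 2)%:E <=
   (1 + m)%:E * \int[mu]_(t in D) (`|f t| ^+ 2)%:E +
   (1 + m^-1)%:E * \int[mu]_(t in D) (`|g t| ^+ 2)%:E)%E.
Proof.
move=> m0 mD smf smg.
have mf := measurable_sqr_norm smf; have mg := measurable_sqr_norm smg.
have m1 : 0 <= 1 + m by rewrite addr_ge0// ltW.
have m2 : 0 <= 1 + m^-1 by rewrite addr_ge0// invr_ge0 ltW.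
rewrite -!ge0_integralZl_EFin//; try by move=> t _; rewrite lee_fin sqr_ge0.
rewrite -ge0_integralD//; last 4 first.
- by move=> t _; rewrite mule_ge0// lee_fin sqr_ge0.
- exact: measurable_funeM.
- by move=> t _; rewrite mule_ge0// lee_fin sqr_ge0.
- exact: measurable_funeM.
apply: ge0_le_integral => //.
- exact: measurable_sqr_norm (strongly_measurableD smf smg).
- by apply: emeasurable_funD; exact: measurable_funeM.
move=> t _; rewrite -!EFinM -EFinD lee_fin.
apply: (@le_trans _ _ ((`|f t| + `|g t|) ^+ 2)).
  by rewrite ler_pXn2r ?nnegrE ?addr_ge0//; exact: ler_normD.
set p := `|f t|; set q := `|g t|.
(* Young's inequality with weight m: the defect is a multiple of a square. *)
have -> : (1 + m) * p ^+ 2 + (1 + m^-1) * q ^+ 2 =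
    (p + q) ^+ 2 + m * (p - m^-1 * q) ^+ 2 by field; rewrite gt_eqF.
by rewrite lerDl mulr_ge0 ?sqr_ge0// ltW.
Qed.

Lemma in_L2S (t0 T : R) f : t0 <= T -> in_L2 T f -> in_L2 t0 f.
Proof.
move=> t0T [mf foo]; have sub : `[0, t0]%classic `<=` `[0, T]%classic.
  by move=> t /=; rewrite !in_itv/= => /andP[-> /le_trans ->].
split; first exact: strongly_measurableS mf.
apply: le_lt_trans foo.
by apply: ge0_subset_integral => //; exact: measurable_sqr_norm.
Qed.

Lemma in_L2_cst T (v : V) : in_L2 T (fun=> v).
Proof.
split; first exact: strongly_measurable_cst.
rewrite integral_cst//.
by apply: lte_mul_pinfty; rewrite ?lee_fin ?sqr_ge0// lebesgue_itvcc_lty.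
Qed.

Lemma in_L2D T f g : in_L2 T f -> in_L2 T g -> in_L2 T (fun t => f t + g t).
Proof.
move=> [mf foo] [mg goo]; split; first exact: strongly_measurableD.
apply: (le_lt_trans (sqr_norm_integralD_le ltr01 _ mf mg)) => //.
by apply: lte_add_pinfty; apply: lte_mul_pinfty; rewrite ?lee_fin.
Qed.

Lemma L2normK T f : in_L2 T f ->
  (L2norm T f ^+ 2)%:E = (\int[mu]_(t in `[0%R, T]) (`|f t| ^+ 2)%:E)%E.
Proof.
move=> [_ foo]; have f0 : (0 <= \int[mu]_(t in `[0%R, T]) (`|f t| ^+ 2)%:E)%E.
  by apply: integral_ge0 => t _; rewrite lee_fin sqr_ge0.
by rewrite sqr_sqrtr ?fine_ge0// fineK// ge0_fin_numE.
Qed.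

(** Serves both controls, continued by [ud], and states, continued by [xd]. *)
Definition hold (t0 : R) f (v : V) (t : R) : V := if t <= t0 then f t else v.

Lemma holdl (t0 : R) f v t : t <= t0 -> hold t0 f v t = f t.
Proof. by rewrite /hold => ->. Qed.

Lemma holdr (t0 : R) f v t : t0 < t -> hold t0 f v t = v.
Proof. by rewrite /hold ltNge; case: leP. Qed.

Lemma strongly_measurable_hold (t0 T : R) f v : 0 <= t0 <= T ->
  strongly_measurable `[0, t0] f -> strongly_measurable `[0, T] (hold t0 f v).
Proof.
move=> t0T mf; rewrite (itvcc_setU t0T); apply: strongly_measurableU => //.
  apply: eq_strongly_measurable mf => t /=; rewrite in_itv/= => /andP[_ tt0].
  by rewrite holdl.
apply: (@eq_strongly_measurable _ _ _ (fun=> v)).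
  by move=> t /=; rewrite in_itv/= => /andP[t0t _]; rewrite holdr.
exact: strongly_measurable_cst.
Qed.

Lemma in_L2_hold0 (t0 T : R) f : 0 <= t0 <= T -> in_L2 t0 f ->
  in_L2 T (hold t0 f 0) /\ L2norm T (hold t0 f 0) = L2norm t0 f.
Proof.
move=> t0T [mf foo]; have mh := strongly_measurable_hold 0 t0T mf.
have intE : (\int[mu]_(t in `[0%R, T]) (`|hold t0 f 0 t| ^+ 2)%:E =
    \int[mu]_(t in `[0%R, t0]) (`|f t| ^+ 2)%:E)%E.
  rewrite (itvcc_setU t0T) ge0_integral_setU//; last 2 first.
  - by rewrite -(itvcc_setU t0T); exact: measurable_sqr_norm.
  - exact: itvcc_disjoint.
  rewrite [X in (_ + X)%E]integral0_eq ?adde0.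
    apply: eq_integral => t /set_mem /=; rewrite in_itv/= => /andP[_ tt0].
    by rewrite holdl.
  move=> t /=; rewrite in_itv/= => /andP[t0t _].
  by rewrite holdr// normr0 expr0n.
by rewrite /in_L2 /L2norm intE.
Qed.

(** Continuing by [v] is continuing [f - v] by 0 and then adding the constant [v]. *)
Lemma in_L2_hold (t0 T : R) f v : 0 <= t0 <= T -> in_L2 t0 f ->
  in_L2 T (hold t0 f v).
Proof.
move=> t0T fL2.
have fv : in_L2 t0 (fun t => f t + - v) by exact: in_L2D (in_L2_cst _ _).
have [hL2 _] := in_L2_hold0 t0T fv.
have := in_L2D hL2 (in_L2_cst T v); congr in_L2; apply/funext => t.
by rewrite /hold; case: ifP; rewrite ?subrK ?add0r.
Qed.

End SquareIntegrable.

Section MildSolutions.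
Context {R : realType} {X U V : completeNormedModType R}.
Variables (S : R -> {linear X -> X}) (domA : set X) (A : X -> X).
Hypotheses (hS : C0_semigroup S) (hA : generated_by_opp S domA A).
Variables (j : {linear X -> V}) (Sm1 : R -> {linear V -> V}).
Hypotheses (hj : extrapolation_space domA A j)
  (hSm1 : extends_semigroup S j Sm1).
Variable B : {linear U -> V}.
Local Notation mild := (mild_solution S j Sm1 B).

Lemma mild_solutionS (t0 T : R) x0 u x : t0 <= T ->
  mild T x0 u x -> mild t0 x0 u x.
Proof.
move=> t0T [cx xP]; split.
  apply: continuous_subspaceW cx => t /=; rewrite !in_itv/= => /andP[-> tt0].
  exact: le_trans t0T.
by move=> t /andP[t00 tt0]; apply: xP; rewrite t00 (le_trans tt0).
Qed.

Lemma mild_solutionD (T : R) x0 u x x0' u' x' :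
  mild T x0 u x -> mild T x0' u' x' ->
  mild T (x0 + x0') (fun t => u t + u' t) (fun t => x t + x' t).
Proof.
move=> [cx xP] [cx' xP']; split.
  by move=> t; apply: cvgD; [exact: cx|exact: cx'].
move=> t tT; rewrite /is_input_to_state (linearD (S t)) opprD addrACA.
rewrite (linearD j).
apply: (eq_bochner_integral _ (bochner_integralD _ (lebesgue_itvcc_lty t)
  (xP t tT) (xP' t tT))) => //.
by move=> s _ /=; rewrite !linearD.
Qed.

(** For t > t0 the input integral is split at t0. On [0, t0] the factor S_{-1}(t - t0) comes out and
    acts on j(xd - S(t0) x0). On ]t0, t] holdability turns B ud into the extended generator at xd,
    whose orbit integral is j(xd - S(t - t0) xd). The sum is j(xd - S(t) x0). *)
Lemma mild_solution_hold (Am1 : {linear X -> V}) (t0 T : R) x0 u x xd ud :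
  extends_generator domA A j Am1 -> holdable B Am1 xd ud ->
  0 < t0 -> t0 <= T -> mild t0 x0 u x -> x t0 = xd ->
  mild T x0 (hold t0 u ud) (hold t0 x xd).
Proof.
move=> hAm1 hd t00 t0T [cx xP] xt0.
have holdE t : t0 <= t -> hold t0 x xd t = xd.
  rewrite le_eqVlt => /orP[/eqP <-|]; last exact: holdr.
  by rewrite holdl.
split.
  (* Pasting continuous functions uses two closed pieces; they overlap at t0, where both
     prescriptions give [xd]. *)
  rewrite (_ : `[0, T]%classic = `[0, t0] `|` `[t0, T]); last first.
    apply/seteqP; split=> t /=; rewrite !in_itv/=.
      by move=> /andP[-> ->]; case: (leP t t0) => [|/ltW ->]; [left|right].
    by move=> [] /andP[]; [move=> -> /le_trans; exact|
      move=> /(le_trans (ltW t00)) -> ->].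
  apply: withinU_continuous; [exact: itv_closed|exact: itv_closed|..].
    apply: subspace_eq_continuous cx => t /set_mem /=.
    by rewrite in_itv/= => /andP[_ tt0]; rewrite [RHS]holdl.
  apply: (@subspace_eq_continuous _ _ _ (fun=> xd)).
    by move=> t /set_mem /=; rewrite in_itv/= => /andP[/holdE/esym].
  by move=> t; exact: cvg_cst.
have input_congr t z : t <= t0 -> is_input_to_state j Sm1 B t u z ->
    is_input_to_state j Sm1 B t (hold t0 u ud) z.
  move=> tt0; apply: eq_bochner_integral => s /=; rewrite in_itv/=.
  by move=> /andP[_ st]; rewrite holdl// (le_trans st).
move=> t /andP[t_ge0 tT]; have [tt0|t0t] := leP t t0.
  by rewrite holdl//; apply: input_congr => //; apply: xP; rewrite t_ge0.
rewrite holdr// /is_input_to_state (@itvcc_setU _ t0 t) ?(ltW t00) ?(ltW t0t)//.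
have tt0 : 0 <= t - t0 by rewrite subr_ge0 ltW.
have [cS jS] := hSm1 tt0.
have -> : j (xd - S t x0) =
    Sm1 (t - t0) (j (xd - S t0 x0)) + j (xd - S (t - t0) xd).
  rewrite jS -linearD; congr (j _).
  have -> : S t x0 = S (t - t0) (S t0 x0).
    by case: hS => _ _ SD _; rewrite -SD ?subrK// ltW.
  by rewrite linearB/= [RHS]addrC addrA subrK.
apply: bochner_integral_setU => //.
- exact: lebesgue_itvcc_lty.
- by rewrite lebesgue_measure_itv/=; case: ifPn => _; rewrite ?ltry.
- exact: itvcc_disjoint.
- have xt0P : is_input_to_state j Sm1 B t0 u (xd - S t0 x0).
    by rewrite -xt0; apply: xP; rewrite lexx ltW.
  apply: eq_bochner_integral (bochner_integral_linear _
    (lebesgue_itvcc_lty t0) cS xt0P) => //.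
  move=> s /=; rewrite in_itv/= => /andP[_ st0]; rewrite holdl//.
  by rewrite -(extended_semigroupD hS hj hSm1)// ?subr_ge0// addrA subrK.
- apply: eq_bochner_integral
    (bochner_integral_extended_orbit hS hA hj hSm1 hAm1 xd t0t).
  move=> s /=; rewrite in_itv/= => /andP[t0s _].
  by rewrite holdr// hd.
Qed.

End MildSolutions.

(** * Exactness of the penalty *)

Lemma objective_hold (R : realType) (X U : normedModType R) (t0 T gamma : R)
    (u : R -> U) (x : R -> X) (xd : X) (ud : U) :
  0 <= t0 <= T -> x t0 = xd -> in_L2 t0 u ->
  objective t0 T gamma xd ud (hold t0 u ud) (hold t0 x xd) =
  2^-1 * L2norm t0 (fun t => u t - ud) ^+ 2.
Proof.
move=> t0T xt0 uL2; have /andP[_ le_t0T] := t0T.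
(* The deviation vanishes throughout [t0, T], and t0 itself shows that the set is not empty. *)
rewrite /objective (_ : [set _ | _ in _] = [set 0]); last first.
  apply/seteqP; split=> [_ [t /= + <-]|_ ->]; last first.
    by exists t0; rewrite /= ?in_itv/= ?lexx// holdl// xt0 subrr normr0.
  rewrite in_itv/= => /andP[]; rewrite le_eqVlt => /orP[/eqP <-|t0t] _.
    by rewrite holdl// xt0 subrr normr0.
  by rewrite holdr// subrr normr0.
rewrite sup1 mulr0 addr0.
have [_ <-] := in_L2_hold0 t0T (in_L2D uL2 (in_L2_cst t0 (- ud))).
congr (_ * L2norm _ _ ^+ 2); apply/funext => t.
by rewrite /hold; case: ifP => // _; rewrite subrr.
Qed.

(** Without an upper bound [sup] would be a default value; the bound lets it dominate each
    deviation. *)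
Lemma has_ubound_state_deviation (R : realType) (X : normedModType R)
    (t0 T : R) (x : R -> X) (xd : X) : 0 <= t0 -> t0 <= T ->
  {within `[0, T], continuous x} ->
  has_ubound [set `|x t - xd| | t in `[t0, T]].
Proof.
move=> t00 t0T cx.
have cx' : {within `[t0, T], continuous x}.
  apply: continuous_subspaceW cx => t /=; rewrite !in_itv/= => /andP[t0t ->].
  by rewrite (le_trans t00).
have cn : {within `[t0, T], continuous (fun t => `|x t - xd|)}.
  by move=> t; apply: cvg_norm; apply: cvgB; [exact: cx'|exact: cvg_cst].
have [c _ cmax] := EVT_max t0T cn.
by exists `|x c - xd| => _ [t tT <-]; exact: cmax.
Qed.

Theorem theorem2 (R : realType) (X U Xm1 : completeNormedModType R)
  (hX : hilbert_norm X) (hU : hilbert_norm U)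
  (S : R -> {linear X -> X}) (domA : set X) (A : X -> X)
  (hS : C0_semigroup S) (hA : generated_by_opp S domA A)
  (j : {linear X -> Xm1}) (hj : extrapolation_space domA A j)
  (Sm1 : R -> {linear Xm1 -> Xm1}) (hSm1 : extends_semigroup S j Sm1)
  (Am1 : {linear X -> Xm1}) (hAm1 : extends_generator domA A j Am1)
  (B : {linear U -> Xm1}) (hB : admissible_control_operator j Sm1 B)
  (x0 : X) (t0 T : R) (ht0 : 0 < t0) (hT : t0 < T)
  (hctrl : exactly_controllable S j Sm1 B t0)
  (xd : X) (ud : U) (hd : holdable B Am1 xd ud) :
  exists2 gamma0 : R, 0 < gamma0 &
    forall gamma : R, gamma0 < gamma ->
    forall (uT : R -> U) (xT : R -> X),
      solves_P S j Sm1 B t0 T gamma x0 xd ud uT xT ->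
      forall t : R, t0 <= t <= T -> xT t = xd.
Proof.
have t0T : 0 <= t0 <= T by rewrite !ltW.
have [C C0 ctrl] := hctrl.
have feasible_hold u x : in_L2 t0 u -> mild_solution S j Sm1 B t0 x0 u x ->
    x t0 = xd -> feasible S j Sm1 B T x0 (hold t0 u ud) (hold t0 x xd).
  move=> uL2 ux xt0; split; first exact: in_L2_hold.
  exact: (mild_solution_hold hS hA hj hSm1 hAm1 hd ht0 (ltW hT) ux xt0).
(* Reference competitor: reach [xd] at t0, then hold. Its cost [K] is independent of gamma. *)
have [u [x [uL2 ux xt0 _]]] := ctrl x0 xd.
pose K := 2^-1 * L2norm t0 (fun t => u t - ud) ^+ 2.
have K0 : 0 <= K by rewrite mulr_ge0 ?sqr_ge0// invr_ge0.
(* If m > 0, the argument below yields gamma <= (a2 + C^2 m + C^2) / 2. Optimality bounds a2 by 2K,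
   and the summand 1 forces gamma >= 1, whence m <= K; the threshold exceeds the resulting bound. *)
exists (1 + K + C ^+ 2 * (K + 1)); first by nra.
move=> gamma gammaK uT xT [[uTL2 uTxT] optimal] t tT.
pose m := sup [set `|xT t - xd| | t in `[t0, T]].
have le_m s : t0 <= s <= T -> `|xT s - xd| <= m.
  move=> sT; apply: ub_le_sup; last by exists s; rewrite //= in_itv.
  by apply: has_ubound_state_deviation (ltW hT) _; [exact: ltW|case: uTxT].
apply/eqP; rewrite -subr_eq0 -normr_le0; apply: (le_trans (le_m t tT)).
rewrite leNgt; apply/negP => m0.
pose a2 := L2norm T (fun t => uT t - ud) ^+ 2.
have a20 : 0 <= a2 by exact: sqr_ge0.
have leK : 2^-1 * a2 + gamma * m <= K.
  have := optimal _ _ (feasible_hold _ _ uL2 ux xt0).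
  by rewrite objective_hold.
(* By superposition [uT + du] reaches [xd] at t0, and the size of [du] is at most C m. *)
have [du [dx [duL2 dudx dxt0 le_du]]] := ctrl 0 (xd - xT t0).
have uTL2' := in_L2S (ltW hT) uTL2.
have vL2 := in_L2D uTL2' duL2.
have := mild_solutionD (mild_solutionS (ltW hT) uTxT) dudx.
rewrite addr0 => vy.
have yt0 : xT t0 + dx t0 = xd by rewrite dxt0 subrKC.
have := optimal _ _ (feasible_hold _ _ vL2 vy yt0).
rewrite objective_hold// => le_b2.
pose b2 := L2norm t0 (fun t => uT t + du t - ud) ^+ 2.
pose d2 := L2norm t0 du ^+ 2.
have le_d2 : d2 <= C ^+ 2 * m ^+ 2.
  rewrite -exprMn ler_pXn2r ?nnegrE ?sqrtr_ge0 ?mulr_ge0 ?(ltW C0) ?(ltW m0)//.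
  apply: (le_trans le_du); rewrite ler_pM2l// normr0 add0r distrC.
  by apply: le_m; rewrite lexx ltW.
have pL2 : in_L2 T (fun t => uT t + - ud) by exact: in_L2D (in_L2_cst _ _).
have pL2' := in_L2S (ltW hT) pL2.
pose c2 := L2norm t0 (fun t => uT t + - ud) ^+ 2.
(* The corrected control costs nothing after t0, so only the part of the optimal cost on [0, t0]
   enters. *)
have le_c2 : c2 <= a2.
  rewrite -lee_fin !L2normK//; apply: ge0_subset_integral => //.
    by apply: measurable_sqr_norm; case: pL2.
  by move=> s /=; rewrite !in_itv/= => /andP[-> /le_trans]; apply; exact: ltW.
(* The weight is the deviation m itself: as d2 is of order m^2, the factor 1/m still leaves a term
   of order m. *)
have le_b2' : b2 <= (1 + m) * c2 + (1 + m^-1) * d2.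
  have qL2 := in_L2D pL2' duL2.
  rewrite /b2 (_ : (fun t => _) = (fun t => (uT t + - ud) + du t)); last first.
    by apply/funext => s; rewrite addrAC.
  rewrite -lee_fin EFinD (EFinM _ c2) (EFinM _ d2) !L2normK//.
  by apply: sqr_norm_integralD_le => //; [case: pL2'|case: duL2].
have main : 2^-1 * a2 + gamma * m <= 2^-1 * b2 by exact: le_b2.
have d2m : (1 + m^-1) * d2 <= C ^+ 2 * m ^+ 2 + C ^+ 2 * m.
  apply: (@le_trans _ _ ((1 + m^-1) * (C ^+ 2 * m ^+ 2))).
    by rewrite ler_wpM2l// addr_ge0// invr_ge0 ltW.
  rewrite mulrDl mul1r lerD2l mulrCA ler_pM2l ?exprn_gt0// expr2 mulrA.
  by rewrite mulVf ?mul1r ?gt_eqF.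
have c2m : (1 + m) * c2 <= (1 + m) * a2.
  by rewrite ler_wpM2l// addr_ge0// ltW.
(* The term a2 / 2 cancels and every remaining term carries a factor m, which is then divided
   out. *)
have le_gm : gamma * m <= 2^-1 * (a2 + C ^+ 2 * m + C ^+ 2) * m by nra.
have le_g : gamma <= 2^-1 * (a2 + C ^+ 2 * m + C ^+ 2).
  by rewrite ler_pM2r in le_gm.
have C20 : 0 <= C ^+ 2 by exact: sqr_ge0.
have CK0 : 0 <= C ^+ 2 * (K + 1) by rewrite mulr_ge0// addr_ge0.
have gm0 : m <= gamma * m by rewrite ler_peMl// ?(ltW m0)//; lra.
have Cm : C ^+ 2 * m <= C ^+ 2 * K by rewrite ler_wpM2l//; lra.
move: gammaK; rewrite mulrDr mulr1; lra.
Qed.
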